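(* Let $\alpha=(\alpha_1,\dots,\alpha_m)$ be a strong composition of $n\ge1$ and $\delta=(\delta_1,\dots,\delta_m)$ a weak composition with $\delta_1=0$, and let $g=\gcd(\alpha_1,\dots,\alpha_m,\delta_1,\dots,\delta_m)$. Let $C_g$ be the cyclic group of order $g$ acting on $\mathcal{W}_{\alpha,\delta}$ generated by rotation by $n/g$ positions. Then $(\mathcal{W}_{\alpha,\delta},C_g,\mathcal{W}^{\mathrm{maj}}_{\alpha,\delta}(q))$ exhibits the cyclic sieving phenomenon.
   Context: A word of length $n$ is a sequence $w=w_1\cdots w_n$ of positive integers; its content is the sequence whose $j$-th entry is the number of $j$'s. $\mathrm{maj}(w)=\sum_{1\le i<n,\,w_i>w_{i+1}}i$. $\mathrm{cdes}(w)=\#\{1\le i\le n:w_i>w_{i+1}\}$ with indices mod $n$ (empty word: 0). $w^{(i)}$ is the subsequence of letters $\le i$. For $w$ of content $\alpha$ with $m$ parts, $\mathrm{CDT}(w)=(\mathrm{cdes}(w^{(1)}),\mathrm{cdes}(w^{(2)})-\mathrm{cdes}(w^{(1)}),\dots,\mathrm{cdes}(w^{(m)})-\mathrm{cdes}(w^{(m-1)}))$. $\mathcal{W}_{\alpha,\delta}$ is the set of words with content $\alpha$ and $\mathrm{CDT}=\delta$ and $\mathcal{W}^{\mathrm{maj}}_{\alpha,\delta}(q)=\sum_{w\in\mathcal{W}_{\alpha,\delta}}q^{\mathrm{maj}(w)}$. Rotation by one position is $w_1\cdots w_{n-1}w_n\mapsto w_nw_1\cdots w_{n-1}$. For a finite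 set $W$ acted on by a cyclic group $C=\langle\tau\rangle$ of order $r$ and $f(q)\in\mathbb{N}[q]$, $(W,C,f(q))$ exhibits the CSP if $\#\{x\in W:\tau^j x=x\}=f(\omega_r^j)$ for all $j\in\mathbb{Z}$, $\omega_r$ a fixed primitive $r$-th root of unity. *)

(* Defs.v *)
From mathcomp Require Import all_boot all_order all_fingroup all_algebra.
From mathcomp Require Import all_field.

Set Implicit Arguments.
Unset Strict Implicit.
Unset Printing Implicit Defensive.

Import GRing.Theory.

Local Open Scope nat_scope.

(* Words are sequences of positive integers; [nth 0 w i] is the letter usually
   written w_(i+1). *)
Definition is_word (w : seq nat) : bool := all (fun x => 0 < x) w.

Definition content (w : seq nat) : seq nat :=
  [seq count_mem j w | j <- iota 1 (\max_(x <- w) x)].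

Definition maj (w : seq nat) : nat :=
  \sum_(1 <= i < size w | nth 0 w i < nth 0 w i.-1) i.

Definition cdes (w : seq nat) : nat :=
  \sum_(0 <= i < size w | nth 0 w (i.+1 %% size w) < nth 0 w i) 1.

Definition letters_upto (i : nat) (w : seq nat) : seq nat :=
  [seq x <- w | x <= i].

(* The first entry is cdes of [letters_upto 1 w], since [letters_upto 0 w] is
   empty for a word w.  The differences are taken in int, as subtraction on
   nat is truncated. *)
Definition CDT (w : seq nat) : seq int :=
  [seq ((cdes (letters_upto i w))%:Z - (cdes (letters_upto i.-1 w))%:Z)%R
     | i <- iota 1 (size (content w))].

(* A word whose content has m parts and sum n is an n-tuple with letters at
   most m; [words_complete] below shows that no word is lost by working in this
   finite type. *)
Definition seq_of n m (w : n.-tuple 'I_m.+1) : seq nat := [seq val x | x <- w].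

Definition words m (alpha delta : m.-tuple nat) :
    {set (sumn alpha).-tuple 'I_m.+1} :=
  [set w | [&& is_word (seq_of w), content (seq_of w) == alpha :> seq nat
             & CDT (seq_of w) == [seq d%:Z | d <- delta]%R]].

Definition words_maj m (alpha delta : m.-tuple nat) : {poly nat} :=
  (\sum_(w in words alpha delta) 'X^(maj (seq_of w)))%R.

Lemma sum_content (w : seq nat) : is_word w -> sumn (content w) = size w.
Proof.
move=> w_gt0; rewrite sumnE big_map; set M := \max_(x <- w) x.
transitivity (\sum_(j <- iota 1 M) \sum_(x <- w) (x == j : nat)).
  by apply: eq_bigr => j _; rewrite -sum1_count big_mkcond.
rewrite exchange_big -sum1_size /=; apply: eq_big_seq => x xw.
have x_in : x \in iota 1 M.
  rewrite mem_iota (allP w_gt0 x xw) add1n ltnS.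
  exact: (leq_bigmax_seq (F := id)).
rewrite (bigD1_seq x) ?iota_uniq //= eqxx big1 // => j.
by rewrite eq_sym => /negPf->.
Qed.

Lemma words_complete m (alpha delta : m.-tuple nat) (s : seq nat) :
  is_word s -> content s = alpha -> CDT s = [seq d%:Z | d <- delta]%R ->
  exists2 w, w \in words alpha delta & seq_of w = s.
Proof.
move=> s_word s_cont s_CDT.
have sz_s : size (map (@inord m) s) == sumn alpha.
  by rewrite size_map -s_cont sum_content.
have max_s : \max_(x <- s) x = m.
  by rewrite -(size_tuple alpha) -s_cont size_map size_iota.
have def_s : seq_of (Tuple sz_s) = s.
  rewrite /seq_of /= -map_comp -[RHS]map_id; apply/eq_in_map => x xs /=.
  rewrite inordK // ltnS -[leqRHS]max_s; exact: (leq_bigmax_seq (F := id)).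
by exists (Tuple sz_s) => //; rewrite inE def_s s_word s_cont s_CDT !eqxx.
Qed.

(* w_1 ... w_n  |->  w_n w_1 ... w_(n-1) *)
Definition rotate n T (w : n.-tuple T) : n.-tuple T := [tuple of rotr 1 w].

Lemma iter_rotate_size n T (w : n.-tuple T) : iter n (@rotate n T) w = w.
Proof.
have iter_rotate i : i <= n -> iter i (@rotate n T) [tuple of rot i w] = w.
  move=> le_in; apply: val_inj => /=.
  have -> k (v : n.-tuple T) : val (iter k (@rotate n T) v) = iter k (rotr 1) v.
    by elim: k => //= k <-.
  elim: i le_in => [|i IHi] lt_in /=; first by rewrite rot0.
  by rewrite -iterS rotS ?size_tuple // iterSr rotK IHi // ltnW.
have w_n : [tuple of rot n w] = w.
  by apply: val_inj; rewrite /= rot_oversize ?size_tuple.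
by rewrite -{1}w_n iter_rotate.
Qed.

(* The cyclic group of order g > 0 is the additive group 'I_g of integers mod g,
   written 'I_g.-1.+1 so that it is a finGroupType; its generator is the class
   of 1.  'Z_g would be wrong here, as 'Z_1 has order 2. *)
Definition cyclic_gen (g : nat) : 'I_g.-1.+1 := inZp 1.

Lemma order_cyclic_gen g : 0 < g -> #[cyclic_gen g]%g = g.
Proof.
case: g => [//|g] _; rewrite -[RHS]card_ord -cardsT /order.
have [-> | g_gt0] := posnP g.
  by apply: eq_card => x; rewrite !inE (ord1 x) group1.
apply: eq_card => x; rewrite !inE; apply/cycleP; exists x.
by rewrite Zp_expg /=; apply: val_inj; rewrite /= modnMml mul1n modn_small.
Qed.

(* The generator acts as rotation by n / g positions. *)
Definition rot_act n g T (w : n.-tuple T) (k : 'I_g.-1.+1) : n.-tuple T :=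
  iter k (iter (n %/ g) (@rotate n T)) w.

Section RotationAction.

Variables (n g : nat) (T : finType).
Hypothesis dvd_g_n : g %| n.

Lemma rot_act1 (w : n.-tuple T) : rot_act w (1%g : 'I_g.-1.+1) = w.
Proof. by []. Qed.

Lemma rot_actM (w : n.-tuple T) (a b : 'I_g.-1.+1) :
  rot_act w (a * b)%g = rot_act (rot_act w a) b.
Proof.
rewrite /rot_act -[RHS]iterD; set f := iter (n %/ g) _.
have f_g v : iter g.-1.+1 f v = v.
  have [g0 | g_gt0] := posnP g; first by rewrite /f g0 divn0.
  by rewrite prednK // /f -iterM mulnC divnK // iter_rotate_size.
have f_mod k v : iter (k %% g.-1.+1) f v = iter k f v.
  rewrite [in RHS](divn_eq k g.-1.+1) addnC iterD iterM.
  by congr (iter _ f _); elim: (_ %/ _) => // i {1}->; rewrite iterS f_g.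
by rewrite /= f_mod addnC.
Qed.

Definition rotation_action : {action 'I_g.-1.+1 &-> n.-tuple T} :=
  TotalAction rot_act1 rot_actM.

Lemma rotation_action_gen (w : n.-tuple T) :
  0 < g -> rotation_action w (cyclic_gen g) = iter (n %/ g) (@rotate n T) w.
Proof.
move=> g_gt0; rewrite /= /rot_act /= prednK //.
have [g1 | g_neq1] := eqVneq g 1; first by rewrite g1 modn1 divn1 iter_rotate_size.
by rewrite modn_small // ltn_neqAle eq_sym g_neq1.
Qed.

End RotationAction.

Definition gcd_parts m (alpha delta : m.-tuple nat) : nat :=
  \big[gcdn/0]_(x <- alpha ++ delta) x.

Lemma gcd_parts_dvd_sum m (alpha delta : m.-tuple nat) :
  gcd_parts alpha delta %| sumn alpha.
Proof.
rewrite /gcd_parts sumnE big_cat /=; apply: dvdn_trans (dvdn_gcdl _ _) _.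
elim: (alpha : seq nat) => [|a s IHs]; first by rewrite !big_nil.
rewrite !big_cons dvdn_add ?dvdn_gcdl //.
exact: dvdn_trans (dvdn_gcdr _ _) IHs.
Qed.

Lemma gcd_parts_gt0 m (alpha delta : m.-tuple nat) :
  0 < sumn alpha -> 0 < gcd_parts alpha delta.
Proof. by move=> n_gt0; apply: dvdn_gt0 n_gt0 (gcd_parts_dvd_sum _ _). Qed.

Definition expgz (gT : finGroupType) (x : gT) (j : int) : gT :=
  match j with Posz k => x ^+ k | Negz k => x ^- k.+1 end%g.

(* Cyclic sieving for the set W, the cyclic group generated by tau, which acts
   on W through [to], and the polynomial f. *)
Definition exhibits_CSP (T : finType) (W : {set T}) (gT : finGroupType)
    (tau : gT) (to : {action gT &-> T}) (f : {poly nat}) : Prop :=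
  [acts <[tau]>%g, on W | to] /\
  forall omega : algC, (#[tau]%g.-primitive_root omega)%R ->
  forall j : int,
    (#|[set w in W | to w (expgz tau j) == w]|%:R
       = (map_poly (fun c : nat => c%:R) f).[omega ^ j] :> algC)%R.

(* Main.v *)
Require Import Defs.
From mathcomp Require Import all_boot all_order all_fingroup all_algebra.
From mathcomp Require Import all_field.
From mathcomp Require Import ring zify.

(* A word fixed by rotation by n/d positions is a d-th power, so for d | g these
   words correspond to W_(alpha/d, delta/d), and one has to show that the sum of
   z^maj over W_(alpha, delta) is #W_(alpha/d, delta/d) for z of order d.  As d
   divides n and all the cyclic descent numbers involved, z^maj is invariant
   under rotation and equal to (1/z)^comaj; double counting then reduces both
   sides to words ending with 1.  Such a word is built by inserting the letters
   2, 3, ... successively.  Inserting a copies of a new largest letter in a word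
   of length n with D descents, so as to create e new descents, multiplies the
   generating function of comaj, whatever the word, by a power of q times
   e_e(1, ..., q^(n-D-1)) h_(a-e)(1, ..., q^(D+e-1)).  At a primitive d-th root
   of unity and for n, D, a, e divisible by d, this factor takes its value at
   q = 1 for n/d, D/d, a/d, e/d. *)

Set Implicit Arguments.
Unset Strict Implicit.
Unset Printing Implicit Defensive.

Import GRing.Theory.

Local Open Scope nat_scope.

(** * Symmetric functions of powers of q *)

Section QBinomial.
Local Open Scope ring_scope.
Variables (R : comNzRingType) (q : R).

(* The generating polynomial of the elementary symmetric functions of
   1, q, ..., q^(n-1). *)
Definition eprod n : {poly R} := \prod_(i < n) (1 + q ^+ i *: 'X).

(* The complete homogeneous symmetric function of degree A of
   1, q, ..., q^(k-1). *)
Fixpoint hsym (k A : nat) : R :=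
  if k is k'.+1 then \sum_(b < A.+1) q ^+ b * hsym k' b else (A == 0%N)%:R.

Lemma hsym0 k : hsym k 0%N = 1.
Proof. by elim: k => //= k IHk; rewrite big_ord1 expr0 mul1r IHk. Qed.

Lemma hsymS k A : hsym k.+1 A.+1 = hsym k.+1 A + q ^+ A.+1 * hsym k A.+1.
Proof. by rewrite /= big_ord_recr. Qed.

Arguments hsym : simpl never.

(* The recurrence that peels off the last variable q^k, whereas the definition
   peels off the first one. *)
Lemma hsym_var k A : hsym k.+1 A.+1 = hsym k A.+1 + q ^+ k * hsym k.+1 A.
Proof.
elim: k A => [|k IHk] A; first by rewrite hsymS /= !mulr0 addr0 add0r mul1r.
elim: A => [|A IHA]; first by rewrite hsymS {1}IHk (hsymS k) !hsym0 !exprS; ring.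
by rewrite hsymS {1}IHA (hsymS k.+1 A) {1}(IHk A.+1) (hsymS k A.+1) !exprS; ring.
Qed.

Lemma eprodS n : eprod n.+1 = eprod n * (1 + q ^+ n *: 'X).
Proof. by rewrite /eprod big_ord_recr. Qed.

Lemma coef_eprod0 n : (eprod n)`_0 = 1.
Proof.
elim: n => [|n IHn]; first by rewrite /eprod big_ord0 coef1.
by rewrite eprodS mulrDr mulr1 -scalerAr coefD coefZ coefMX IHn mulr0 addr0.
Qed.

Lemma coef_eprodS n e :
  (eprod n.+1)`_e.+1 = (eprod n)`_e.+1 + q ^+ n * (eprod n)`_e.
Proof. by rewrite eprodS mulrDr mulr1 -scalerAr coefD coefZ coefMX. Qed.

Lemma coefMl_agree (p r s : {poly R}) m :
  (forall i, (i <= m)%N -> r`_i = s`_i) ->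
  forall i, (i <= m)%N -> (p * r)`_i = (p * s)`_i.
Proof.
move=> eq_rs i le_im; rewrite !coefM; apply: eq_bigr => j _.
by rewrite eq_rs // (leq_trans (leq_subr _ _)).
Qed.

(* The generating series of hsym is inverse to the product of the 1 - q^i X; it
   is truncated at degree m to stay among polynomials. *)
Lemma coef_prod_hsym k j m A : (A <= m)%N ->
  ((\prod_(i < j) (1 - q ^+ (k + i) *: 'X)) * \poly_(i < m.+1) hsym (k + j) i)`_A
    = hsym k A.
Proof.
elim: j A => [|j IHj] A le_Am.
  by rewrite big_ord0 mul1r coef_poly addn0 ltnS le_Am.
rewrite big_ord_recr /= -mulrA -[RHS](IHj A) //.
apply: coefMl_agree le_Am => i le_im.
rewrite mulrBl mul1r -scalerAl coefB coefZ coefXM !coef_poly ltnS le_im addnS.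
case: i le_im => [|i] lt_im; first by rewrite !hsym0 mulr0 subr0.
by rewrite /= (leqW lt_im) hsym_var addrK.
Qed.
End QBinomial.
Arguments hsym : simpl never.

Lemma binD2 a b : 'C(a + b, 2) = ('C(a, 2) + 'C(b, 2) + a * b)%N.
Proof.
elim: b => [|b IHb]; first by rewrite addn0 muln0 !addn0.
rewrite addnS !binS !bin1 IHb; lia.
Qed.

(** [eprod 1 N] is $(1+X)^N$, so its coefficients are binomial coefficients; they are kept in this
    form to match the values of [eprod] at $q=1$. *)
Lemma coef_linear_exp (R : comNzRingType) (c : R) N E :
  (((1 + c *: 'X) ^+ N)`_E = c ^+ E * (eprod 1 N)`_E)%R.
Proof.
elim: N E => [|N IHN] [|E]; rewrite ?expr0 ?coef1 ?exprSr ?mulr0 ?mul1r //.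
- by rewrite /eprod big_ord0 coef1.
- by rewrite /eprod big_ord0 coef1 mulr0.
- rewrite mulrDr mulr1 -scalerAr coefD coefZ coefMX mulr0 addr0 IHN.
  by rewrite !coef_eprod0 expr0 mulr1.
rewrite mulrDr mulr1 -scalerAr coefD coefZ coefMX /= !IHN coef_eprodS expr1n.
rewrite exprS; ring.
Qed.

(** * Values at a primitive root of unity *)

Section RootOfUnity.
Local Open Scope ring_scope.
Variables (F : fieldType) (d : nat) (xi : F).
Hypothesis prim_xi : d.-primitive_root xi.

Let d_gt0 : (0 < d)%N := prim_order_gt0 prim_xi.

Lemma prim_rootV : d.-primitive_root xi^-1.
Proof.
have <- : xi ^+ d.-1 = xi^-1.
  have xi_neq0 : xi != 0 by rewrite (prim_root_eq0 prim_xi) -lt0n.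
  by apply: (mulfI xi_neq0); rewrite -exprS prednK // (prim_expr_order prim_xi) divff.
by rewrite (prim_root_exp_coprime _ prim_xi) coprimePn.
Qed.

(** Substitute $-X$ for $X$ in $X^d-1=\prod_i(X-\xi^i)$. *)
Lemma prim_prodD : \prod_(i < d) ('X + (xi ^+ i)%:P) = 'X^d - (- 1) ^+ d :> {poly F}.
Proof.
transitivity (\prod_(i < d) - (('X - (xi ^+ i)%:P) \Po - 'X)).
  apply: eq_bigr => i _.
  by rewrite comp_polyB comp_polyX comp_polyC opprB opprK addrC.
rewrite prodrN card_ord -rmorph_prod -(big_mkord xpredT (fun i => 'X - (xi ^+ i)%:P)).
rewrite (factor_Xn_sub_1 prim_xi) /= rmorphB rmorphXn rmorph1 /= comp_polyX (exprNn 'X).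
by rewrite mulrBr mulr1 mulrA -expr2 sqrr_sign mul1r.
Qed.
End RootOfUnity.

Section RootOfUnityValues.
Local Open Scope ring_scope.
Variables (F : fieldType) (d : nat) (xi : F).
Hypothesis prim_xi : d.-primitive_root xi.

Let d_gt0 : (0 < d)%N := prim_order_gt0 prim_xi.

(** Each factor $1+\xi^iX$ equals $\xi^i(X+\xi^{-i})$, and [prim_prodD] for $\xi^{-1}$ evaluates the
    remaining product. The constant coefficient of [eprod] is 1, which yields the sign $\xi^{\binom
    d2}$ without a discussion of the parity of $d$. *)
Lemma eprod_prim_sign : xi ^+ 'C(d, 2) = - (-1) ^+ d
  /\ eprod xi d = 1 + xi ^+ 'C(d, 2) *: 'X^d.
Proof.
have xi_neq0 : xi != 0 by rewrite (prim_root_eq0 prim_xi) -lt0n.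
have : eprod xi d = xi ^+ 'C(d, 2) *: ('X^d - (-1) ^+ d).
  rewrite -(prim_prodD (prim_rootV prim_xi)) -bin2_sum expr_sum big_mkord -scaler_prod.
  apply: eq_bigr => i _; rewrite scalerDr addrC; congr (_ + _).
  rewrite -mul_polyC -polyCM exprVn.
  by rewrite divff ?expf_neq0.
have -> : (-1) ^+ d = ((-1) ^+ d)%:P :> {poly F} by rewrite rmorphXn rmorphN1.
rewrite scalerBr => def_e; have := coef_eprod0 xi d.
rewrite def_e coefB !coefZ coefXn coefC /=.
have -> : (0%N == d) = false by rewrite eq_sym eqn0Ngt d_gt0.
rewrite mulr0 sub0r => s_sgn; split.
  by rewrite -[RHS]mulr1 -[X in _ * X]s_sgn mulrN mulNr opprK mulrCA -expr2 sqrr_sign mulr1.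
by rewrite addrC -mul_polyC -polyCM -polyCN s_sgn.
Qed.

Let s := xi ^+ 'C(d, 2).

(** The exponents split into $N$ blocks of $d$ consecutive ones, each running through all residues
    modulo $d$. *)
Lemma eprod_mul_prim N : eprod xi (d * N) = (1 + s *: 'X^d) ^+ N.
Proof.
elim: N => [|N IHN]; first by rewrite muln0 /eprod big_ord0.
rewrite mulnSr exprSr -IHN -(eprod_prim_sign).2 /eprod big_split_ord /=.
congr (_ * _); apply: eq_bigr => i _.
by rewrite exprD exprM (prim_expr_order prim_xi) expr1n mul1r.
Qed.

(** By [binD2], $\binom{dE}{2}\equiv E\binom d2$ modulo $d$; and $s^2=1$ because $2\binom
    d2=d(d-1)$. *)
Lemma prim_bin2_exp E : xi ^+ 'C(d * E, 2) * s ^+ E = 1.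
Proof.
have xi_d := prim_expr_order prim_xi.
have ss : s * s = 1.
  rewrite -exprD addnn -mul2n -mul_bin_diag bin1 exprM xi_d expr1n //.
elim: E => [|E IHE]; first by rewrite muln0 bin0n !expr0 mulr1.
rewrite mulnS binD2 !exprD exprS [xi ^+ (d * _)]exprM xi_d expr1n mulr1.
by rewrite mulrACA ss mul1r.
Qed.

Lemma coef_eprod_prim N E :
  xi ^+ 'C(d * E, 2) * (eprod xi (d * N))`_(d * E) = (eprod 1 N)`_E.
Proof.
rewrite eprod_mul_prim.
have -> : (1 + s *: 'X^d) ^+ N = (1 + s *: 'X) ^+ N \Po 'X^d.
  by rewrite rmorphXn rmorphD rmorph1 /= comp_polyZ comp_polyX.
rewrite coef_comp_poly_Xn // dvdn_mulr // mulKn // coef_linear_exp mulrA.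
by rewrite prim_bin2_exp mul1r.
Qed.

Lemma prim_prod_1B k : \prod_(i < d) (1 - xi ^+ (d * k + i) *: 'X) = 1 - 'X^d.
Proof.
have [s_sgn def_e] := eprod_prim_sign.
transitivity (eprod xi d \Po - 'X).
  rewrite rmorph_prod; apply: eq_bigr => i _; rewrite rmorphD rmorph1 /= comp_polyZ.
  by rewrite comp_polyX exprD exprM (prim_expr_order prim_xi) expr1n mul1r scalerN.
rewrite def_e rmorphD rmorph1 /= comp_polyZ rmorphXn /= comp_polyX s_sgn.
rewrite (exprNn 'X) scaleNr -signr_odd -[X in _ *: (X * _)]signr_odd.
by case: (odd d); rewrite ?scale1r ?mul1r // scaleN1r mulN1r opprK.
Qed.

(** Dropping the last $d$ variables multiplies the generating series by the product of their
    factors, which is $1-X^d$ by [prim_prod_1B]. *)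
Lemma hsym_prim_rec k a : hsym xi (d * k.+1) a =
  hsym xi (d * k) a + (if (a < d)%N then 0 else hsym xi (d * k.+1) (a - d)%N).
Proof.
have := coef_prod_hsym xi (d * k) d (leqnn a).
rewrite prim_prod_1B mulrBl mul1r coefB coefXnM !coef_poly ltnSn -mulnSr => <-.
by rewrite ltnS leq_subr subrK.
Qed.

Lemma hsym_prim k A : hsym xi (d * k) (d * A) = hsym 1 k A.
Proof.
elim: k A => [|k IHk] A; first by rewrite muln0 /hsym muln_eq0 eqn0Ngt d_gt0.
elim: A => [|A IHA]; first by rewrite muln0 !hsym0.
(* At degrees divisible by $d$ the recurrence becomes [hsym_var] at $q=1$. *)
rewrite hsym_prim_rec ltnNge leq_pmulr // mulnS addKn IHA -mulnS IHk.
by rewrite hsym_var expr1n mul1r.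
Qed.

End RootOfUnityValues.

(** * Insertion of a largest letter *)

Fixpoint des (s : seq nat) : nat :=
  if s is x :: s' then (if s' is y :: _ then (y < x) + des s' else 0) else 0.

(* A descent at position i counts for size s - i instead of i: the weight of the
   part after a letter then does not depend on what precedes it. *)
Fixpoint comaj (s : seq nat) : nat :=
  if s is x :: s' then
    (if s' is y :: _ then (y < x) * size s' + comaj s' else 0)
  else 0.

Lemma des_cons2 x y s : des (x :: y :: s) = (y < x) + des (y :: s).
Proof. by []. Qed.

Lemma comaj_cons2 x y s :
  comaj (x :: y :: s) = (y < x) * (size s).+1 + comaj (y :: s).
Proof. by []. Qed.

Arguments des : simpl never.
Arguments comaj : simpl never.

Lemma des_size x s : des (x :: s) <= size s.
Proof.
elim: s x => [//|y s IHs] x; rewrite des_cons2 /= -add1n.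
exact: leq_add (leq_b1 _) (IHs _).
Qed.

(* [shuf M v a] lists the words obtained by inserting [a] letters [M] in [v],
   none of them after the last letter of [v]. *)
Fixpoint shuf (M : nat) (v : seq nat) : nat -> seq (seq nat) :=
  if v is x :: v' then
    fix aux a := map (cons x) (shuf M v' a) ++
                 (if a is a'.+1 then map (cons M) (aux a') else [::])
  else fun a => if a is 0 then [:: [::]] else [::].

Lemma shuf_cons0 M x v : shuf M (x :: v) 0 = map (cons x) (shuf M v 0).
Proof. by rewrite /= cats0. Qed.

Lemma shuf_consS M x v a : shuf M (x :: v) a.+1 =
  map (cons x) (shuf M v a.+1) ++ map (cons M) (shuf M (x :: v) a).
Proof. by []. Qed.

Arguments shuf : simpl never.

Lemma mem_map_cons (x : nat) (z : nat) w l :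
  (z :: w \in map (cons x) l) = (z == x) && (w \in l).
Proof.
apply/mapP/andP => [[u ul [-> ->]] // | [/eqP-> wl]]; by exists w.
Qed.

(** Deleting the letters [M] recovers [v], since [M] does not occur in [v]. The disjunct [w == [::]]
    serves the empty [v], into which nothing can be inserted. *)
Lemma mem_shuf M v a w : M \notin v ->
  (w \in shuf M v a) = [&& [seq x <- w | x != M] == v, count_mem M w == a
                         & (w == [::]) || (last 0 w != M)].
Proof.
elim: w v a => [|z w IHw] v a Mv.
  case: v Mv => [|x v] Mv; first by case: a.
  have nil_map y l : ([::] \in map (cons y) l) = false :> bool.
    by apply/mapP => -[].
  by elim: a => [|a IHa]; rewrite ?shuf_cons0 ?shuf_consS ?mem_cat ?nil_map // IHa.
case: v Mv => [|x v] Mv.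
  have nil_last : [seq x <- z :: w | x != M] == [::] -> last z w = M.
    move=> /eqP w_nil; apply/eqP; apply: contraT => nM.
    have : last z w \in [seq x <- z :: w | x != M] by rewrite mem_filter nM mem_last.
    by rewrite w_nil.
  have -> : (z :: w \in shuf M [::] a) = false by case: a.
  by apply/esym/negbTE/negP => /and3P[/nil_last /= -> _]; rewrite eqxx.
move: (Mv); rewrite inE negb_or eq_sym => /andP[xM Mv'].
have last_z : (z :: w == [::]) || (last 0 (z :: w) != M)
    = if w is [::] then z != M else last 0 w != M.
  by case: w {IHw}.
rewrite last_z.
have [-> | zM] := eqVneq z M.
  have Mx : (M == x) = false by rewrite eq_sym (negPf xM).
  case: a => [|a]; first by rewrite shuf_cons0 mem_map_cons Mx /= eqxx andbF.
  rewrite shuf_consS mem_cat !mem_map_cons Mx (IHw (x :: v) a Mv) /= !eqxx /= add1n eqSS.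
  by case: w {IHw last_z}.
have -> : (if w is [::] then true else last 0 w != M) = (w == [::]) || (last 0 w != M).
  by case: w {IHw last_z}.
rewrite /= (negPf zM) add0n eqseq_cons -andbA -(IHw v a Mv').
case: a => [|a]; first by rewrite shuf_cons0 mem_map_cons.
by rewrite shuf_consS mem_cat !mem_map_cons (negPf zM) orbF.
Qed.

Lemma shuf_uniq M v a : M \notin v -> uniq (shuf M v a).
Proof.
have inj_cons y : injective (@cons nat y) by move=> s1 s2 [].
elim: v a => [|x v IHv] a; first by case: a.
rewrite inE negb_or eq_sym => /andP[xM Mv].
elim: a => [|a IHa]; first by rewrite shuf_cons0 map_inj_uniq ?IHv.
rewrite shuf_consS cat_uniq !map_inj_uniq ?IHv ?IHa //= andbT.
apply/hasPn => _ /mapP[w _ ->]; rewrite mem_map_cons eq_sym.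
by rewrite (negPf xM).
Qed.

(** * Generating function of comaj over the insertions *)

Section ShuffleSum.
Variables (R : comNzRingType) (q : R).
Local Open Scope ring_scope.

(* Inserting a letters M in a word of length n with D descents, so as to create
   e new ones: eprod accounts for the choice of the e ascents where descents are
   created, hsym for the distribution of the a - e further letters among the
   D + e descents. *)
Definition shuf_weight n D a e : R :=
  if (e <= a)%N then
    q ^+ (e * D.+1 + 'C(e, 2)) * (eprod q (n - D))`_e * hsym q (D + e) (a - e)
  else 0.

(* The letter x in front is the predecessor of w; it may be M. *)
Definition shuf_sum M x v a t : R :=
  \sum_(w <- shuf M v a | des (x :: w) == t) q ^+ comaj (x :: w).

Lemma size_shuf M v a w : w \in shuf M v a -> size w = (size v + a)%N.
Proof.
elim: v a w => [|x v IHv] a w; first by case: a => //; rewrite inE => /eqP->.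
elim: a w => [|a IHa] w.
  by rewrite shuf_cons0 => /mapP[u /IHv uv ->]; rewrite /= uv.
rewrite shuf_consS mem_cat => /orP[] /mapP[u].
  by move=> /IHv uv ->; rewrite /= uv.
by move=> /IHa uv ->; rewrite /= uv addnS.
Qed.

(** A descent from [x] to [y] weighs the length of what follows [x]. This is the same for all
    insertions, so it factors out. *)
Lemma shuf_sum_cons M x y v a t :
  \sum_(w <- shuf M v a | des (x :: y :: w) == t) q ^+ comaj (x :: y :: w) =
  if (y < x)%N then
    if t is t'.+1 then q ^+ (size v + a).+1 * shuf_sum M y v a t' else 0
  else shuf_sum M y v a t.
Proof.
rewrite /shuf_sum; under eq_bigl do rewrite des_cons2.
case: ifP => lt_yx /=; last first.
  by apply: eq_bigr => w _; rewrite comaj_cons2 lt_yx mul0n.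
case: t => [|t]; first by rewrite big1.
rewrite big_distrr /= big_seq_cond [RHS]big_seq_cond; apply: eq_big => w.
  by rewrite add1n eqSS.
by case/andP=> /size_shuf <- _; rewrite comaj_cons2 lt_yx mul1n exprD.
Qed.

Lemma shuf_sum0 M x y v t : shuf_sum M x (y :: v) 0 t =
  if (y < x)%N then
    if t is t'.+1 then q ^+ (size v).+1 * shuf_sum M y v 0 t' else 0
  else shuf_sum M y v 0 t.
Proof.
by rewrite {1}/shuf_sum shuf_cons0 big_map shuf_sum_cons addn0.
Qed.

(** The inserted word begins with [y] or with [M]. In the second case [x <= M] creates no descent,
    and what remains is an insertion after the letter [M]. *)
Lemma shuf_sumS M x y v a t : (x <= M)%N -> shuf_sum M x (y :: v) a.+1 t =
  (if (y < x)%N then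
    if t is t'.+1 then q ^+ (size v + a.+1).+1 * shuf_sum M y v a.+1 t' else 0
  else shuf_sum M y v a.+1 t) + shuf_sum M M (y :: v) a t.
Proof.
move=> le_xM; rewrite {1}/shuf_sum shuf_consS big_cat !big_map shuf_sum_cons.
congr (_ + _); apply: eq_big => w; first by rewrite des_cons2 ltnNge le_xM.
by rewrite comaj_cons2 ltnNge le_xM.
Qed.

Lemma shuf_weight_desc0 n D e : shuf_weight n.+1 D.+1 0 e = shuf_weight n D 0 e.
Proof.
by rewrite /shuf_weight leqn0; case: eqP => // ->; rewrite !coef_eprod0 !hsym0 !mul0n.
Qed.

(** This is [hsymS]: $n-D$ is unchanged while [hsym] has one more variable. *)
Lemma shuf_weight_descS n D a e :
  shuf_weight n.+1 D.+1 a.+1 e =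
  q ^+ a.+1 * shuf_weight n D a.+1 e + shuf_weight n.+1 D.+1 a e.
Proof.
rewrite /shuf_weight subSS; case: (ltngtP e a.+1) => [lt_ea | lt_ae | ->].
- have le_ea : (e <= a)%N by [].
  rewrite le_ea addSn (subSn le_ea) hsymS.
  have -> : (e * D.+2 + 'C(e, 2) = e + (e * D.+1 + 'C(e, 2)))%N by lia.
  have -> : q ^+ a.+1 = q ^+ e * q ^+ (a - e).+1.
    by rewrite -exprD; congr (_ ^+ _); lia.
  rewrite exprD; ring.
- by rewrite leqNgt (ltn_trans _ lt_ae) //= mulr0 addr0.
rewrite ltnn subnn !hsym0 !mulr1 addr0 mulrA -exprD; congr (_ ^+ _ * _); lia.
Qed.

Lemma shuf_weight_asc0 n D e : shuf_weight n.+1 D 0 e = shuf_weight n D 0 e.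
Proof. by rewrite /shuf_weight leqn0; case: eqP => // ->; rewrite !coef_eprod0. Qed.

Lemma shuf_weight_ascS0 n D a : shuf_weight n.+1 D a 0 = shuf_weight n D a 0.
Proof. by rewrite /shuf_weight !coef_eprod0. Qed.

(** This is [coef_eprodS]: the new ascent is the last variable of [eprod], and the second term is
    the case where a descent is created there. *)
Lemma shuf_weight_ascS n D a e : (D <= n)%N ->
  shuf_weight n.+1 D a.+1 e.+1 =
  shuf_weight n D a.+1 e.+1 + q ^+ n.+1 * shuf_weight n.+1 D.+1 a e.
Proof.
move=> le_Dn; rewrite /shuf_weight ltnS !subSS; case: leqP => _;
  last by rewrite mulr0 addr0.
rewrite (subSn le_Dn) coef_eprodS addnS addSn.
rewrite mulrDr mulrDl; congr (_ + _); rewrite !mulrA -!exprD.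
by congr (_ ^+ _ * _ * _); rewrite binS bin1; lia.
Qed.

(** Indexed by the total number [t] of descents instead of the number of new ones; inserting a
    largest letter never destroys a descent, whence 0 for [t < D]. *)
Definition shuf_weight_at n D a t : R :=
  if (D <= t)%N then shuf_weight n D a (t - D) else 0.

(** The case where the preceding letter is [M] itself, by induction on [a]: another [M] in front
    gives no descent, and the step from [M] to [y] is one more old descent. *)
Lemma shuf_sum_desc M y v a t : (y < M)%N ->
  (forall b u, shuf_sum M y v b u =
     q ^+ comaj (y :: v) * shuf_weight_at (size v) (des (y :: v)) b u) ->
  shuf_sum M M (y :: v) a t =
  q ^+ (comaj (y :: v) + (size v).+1) * shuf_weight_at (size v).+1 (des (y :: v)).+1 a t.
Proof.
move=> lt_yM IHv; set D := des _; set c := comaj _; elim: a => [|a IHa].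
  rewrite shuf_sum0 lt_yM; case: t => [|t]; first by rewrite /shuf_weight_at mulr0.
  by rewrite IHv mulrA -exprD addnC /shuf_weight_at ltnS subSS shuf_weight_desc0.
rewrite shuf_sumS // lt_yM IHa; case: t {IHa} => [|t];
  first by rewrite /shuf_weight_at mulr0 addr0.
rewrite IHv /shuf_weight_at ltnS subSS; case: ifP => _; last by rewrite !mulr0 addr0.
rewrite shuf_weight_descS -/D -/c -[(size v + a.+1).+1]addSn !exprD; ring.
Qed.

Lemma shuf_sumE M x v a t : (x < M)%N -> all (fun y => y < M)%N v ->
  shuf_sum M x v a t = q ^+ comaj (x :: v) * shuf_weight_at (size v) (des (x :: v)) a t.
Proof.
elim: v x a t => [|y v IHv] x a t lt_xM.
  (* With [v] empty there are no ascents and no descents, so both sides vanish unless [a] and [t]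
     are 0. *)
  move=> _; rewrite /shuf_sum /shuf_weight_at /shuf_weight subn0 mul1r /eprod
    big_ord0 coef1.
  case: a => [|a] /=; last first.
    rewrite /shuf /= big_nil; case: t => [|t] /=; first by rewrite mulr0.
    by case: ifP => _; rewrite ?mulr0 ?mul0r.
  rewrite /shuf /= big_cons big_nil eq_sym addr0.
  by case: t => [|t] //=; rewrite !expr0 !mul1r hsym0.
move=> /= /andP[lt_yM lt_vM].
have IHy b u : shuf_sum M y v b u =
     q ^+ comaj (y :: v) * shuf_weight_at (size v) (des (y :: v)) b u by exact: IHv.
rewrite comaj_cons2 des_cons2; have [lt_yx | le_xy] := ltnP y x.
  (* Of the preceding letter only its comparisons with [y] and [M] matter, so [x > y] behaves like
     [M]. *)
  transitivity (shuf_sum M M (y :: v) a t).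
    case: a => [|a]; first by rewrite !shuf_sum0 lt_yx lt_yM.
    by rewrite !shuf_sumS // ?(ltnW lt_xM) // lt_yx lt_yM.
  by rewrite (shuf_sum_desc a t lt_yM IHy) mul1n add1n addnC.
rewrite mul0n !add0n; set D := des _; set c := comaj _.
case: a => [|a].
  by rewrite shuf_sum0 ltnNge le_xy /= IHy /shuf_weight_at shuf_weight_asc0.
rewrite shuf_sumS ?(ltnW lt_xM) // ltnNge le_xy /= IHy (shuf_sum_desc a t lt_yM IHy).
rewrite -/D -/c exprD -mulrA -mulrDr; congr (_ * _).
have le_Dn : (D <= size v)%N by exact: des_size.
rewrite /shuf_weight_at; have [le_Dt | lt_tD] := leqP D t; last first.
  by rewrite ltnNge ltnW // mulr0 addr0.
(* If [t = D] no descent is created, so [M] cannot come first; otherwise the number of new descents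
   is a successor. *)
case: ltngtP le_Dt => // [lt_Dt|->] _; last by rewrite subnn mulr0 addr0 shuf_weight_ascS0.
have -> : (t - D = (t - D.+1).+1)%N by lia.
by rewrite shuf_weight_ascS.
Qed.
End ShuffleSum.

(** Of the exponent of [xi], the part [d * e * (d * D).+1] is a multiple of [d], and the binomial
    part is absorbed by [coef_eprod_prim]. *)
Lemma shuf_weight_prim (F : fieldType) d (xi : F) n D a e : d.-primitive_root%R xi ->
  shuf_weight xi (d * n) (d * D) (d * a) (d * e) = shuf_weight 1%R n D a e.
Proof.
move=> prim_xi; have d_gt0 := prim_order_gt0 prim_xi.
rewrite /shuf_weight leq_pmul2l //; case: ifP => // _.
rewrite -!mulnBr -mulnDr hsym_prim // -(coef_eprod_prim prim_xi).
by rewrite exprD -mulnA exprM (prim_expr_order prim_xi) !expr1n !mul1r.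
Qed.

(** * Words ending with 1 *)

Lemma last_filter (T : Type) (p : pred T) x s :
  p (last x s) -> last x (filter p s) = last x s.
Proof.
by case/lastP: s => // s y; rewrite filter_rcons last_rcons => ->; rewrite last_rcons.
Qed.

Lemma letters_upto_filter M i s :
  i < M -> letters_upto i [seq x <- s | x != M] = letters_upto i s.
Proof.
move=> lt_iM; rewrite /letters_upto -filter_predI; apply: eq_filter => x /=.
by have [le_xi|//] := leqP x i; rewrite neq_ltn (leq_ltn_trans le_xi).
Qed.

Lemma letters_upto_id i s : all (fun x => x <= i) s -> letters_upto i s = s.
Proof. by move/all_filterP. Qed.

(* The words that end with 1 and have alpha j letters j.+1 for all j <= k. *)
Fixpoint words_end1 (alpha : nat -> nat) (k : nat) : seq (seq nat) :=
  if k is k'.+1 then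
    [seq w | v <- words_end1 alpha k', w <- shuf k'.+2 v (alpha k'.+1)]
  else [:: nseq (alpha 0) 1].

(* For a word t ending with 1, cdes t = des (1 :: t). *)
Fixpoint has_cdt (delta : nat -> nat) (k : nat) (t : seq nat) : bool :=
  (des (1 :: letters_upto k.+1 t) == \sum_(j < k.+1) delta j)
  && (if k is k'.+1 then has_cdt delta k' t else true).

Lemma has_cdtP (delta : nat -> nat) k t :
  reflect (forall i, i <= k ->
             des (1 :: letters_upto i.+1 t) = \sum_(j < i.+1) delta j)
          (has_cdt delta k t).
Proof.
elim: k => [|k IHk] /=.
  rewrite andbT; apply: (iffP eqP) => [h i|-> //]; by rewrite leqn0 => /eqP->.
apply: (iffP andP) => [[/eqP h /IHk hk] i|h].
  by rewrite leq_eqVlt => /orP[/eqP->|]; last exact: hk.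
by split; [rewrite h | apply/IHk => i le_ik; apply/h/leqW].
Qed.

Section EndOne.
Variable (alpha : nat -> nat).
Hypothesis alpha0 : 0 < alpha 0.

(** Deleting the largest letter inverts each insertion, and [shuf] never touches the final 1. The
    default 0 of [last] rules out the empty word. *)
Lemma words_end1P k t :
  reflect [/\ all (fun x => 0 < x <= k.+1) t, last 0 t = 1
             & forall j, j <= k -> count_mem j.+1 t = alpha j]
          (t \in words_end1 alpha k).
Proof.
elim: k t => [|k IHk] t /=.
  rewrite inE; apply: (iffP eqP) => [->|[t1 _ /(_ 0 isT)]].
    split; first by rewrite all_nseq orbT.
      by case: (alpha 0) alpha0 => // n _ /=; elim: n.
    by case=> // _; rewrite count_nseq mul1n.
  have /all_pred1P : all (pred1 1) t.
    by apply: sub_all t1 => x; rewrite -eqn_leq eq_sym.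
  by move=> def_t; rewrite {1}def_t count_nseq mul1n => <-.
apply: (iffP allpairsPdep) => [[v [w [vL wS ->]]] | [t_le t_last t_cnt]].
  have [v_le v_last v_cnt] := IHk _ vL.
  have Mv : k.+2 \notin v.
    by apply/negP => /(allP v_le); rewrite ltnn andbF.
  move: wS; rewrite mem_shuf // => /and3P[/eqP def_v /eqP cnt_w w_last].
  have w_nil : w != [::].
    by apply: contraTneq isT => w0; move: v_last; rewrite -def_v w0.
  rewrite (negPf w_nil) /= in w_last.
  have cnt_filter j : j <= k -> count_mem j.+1 v = count_mem j.+1 w.
    move=> le_jk; rewrite -def_v count_filter; apply: eq_count => x /=.
    by case: eqP => //= ->; rewrite neq_ltn ltnS ltnS le_jk.
  split.
  - apply/allP => x xw; have [->|xM] := eqVneq x k.+2; first exact: leqnn.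
    have : x \in v by rewrite -def_v mem_filter xM.
    by move/(allP v_le)/andP => [-> /leqW].
  - by rewrite -v_last -def_v last_filter.
  move=> j; rewrite leq_eqVlt => /orP[/eqP-> //|le_jk].
  by rewrite -cnt_filter ?v_cnt.
exists [seq x <- t | x != k.+2], t; split=> //; last first.
  rewrite mem_shuf ?mem_filter ?eqxx //= t_cnt // eqxx /=.
  by rewrite t_last orbT.
apply/IHk; split.
- apply/allP => x; rewrite mem_filter => /andP[xM /(allP t_le)].
  by rewrite [x <= _]leq_eqVlt (negPf xM).
- by rewrite last_filter ?t_last.
move=> j le_jk; rewrite count_filter -t_cnt ?(leqW le_jk) //.
apply: eq_count => x /=.
by case: eqP => //= ->; rewrite neq_ltn ltnS ltnS le_jk.
Qed.

Lemma words_end1_lt k v :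
  v \in words_end1 alpha k -> all (fun y => y < k.+2) v.
Proof. by case/words_end1P => v_le _ _; apply: sub_all v_le => x /andP[]. Qed.

Lemma notin_words_end1 k v : v \in words_end1 alpha k -> k.+2 \notin v.
Proof.
by move/words_end1_lt => v_lt; apply/negP => /(allP v_lt); rewrite ltnn.
Qed.

Lemma words_end1_uniq k : uniq (words_end1 alpha k).
Proof.
elim: k => //= k IHk; apply: allpairs_uniq_dep => //.
  by move=> v vL; apply: shuf_uniq; apply: notin_words_end1.
move=> _ _ /allpairsPdep[v1 [w1 [v1L w1S ->]]] /allpairsPdep[v2 [w2 [v2L w2S ->]]] /= eq_w.
move: w1S w2S; rewrite -{}eq_w !mem_shuf ?notin_words_end1 //.
by move=> /andP[/eqP-> _] /andP[/eqP-> _].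
Qed.

Lemma size_words_end1 k v :
  v \in words_end1 alpha k -> size v = \sum_(j < k.+1) alpha j.
Proof.
elim: k v => [|k IHk] v /=; first by rewrite inE big_ord1 => /eqP->; rewrite size_nseq.
by case/allpairsPdep => u [w [/IHk su /size_shuf sw ->]]; rewrite big_ord_recr /= -su.
Qed.

Variables (delta : nat -> nat) (R : comNzRingType) (q : R).
Local Open Scope ring_scope.

Definition sum_end1 k : R :=
  \sum_(t <- words_end1 alpha k | has_cdt delta k t) q ^+ comaj t.

Lemma comaj_cons1 k t : t \in words_end1 alpha k -> comaj (1%N :: t) = comaj t.
Proof.
case/words_end1P; case: t => [|x t] //= /andP[/andP[x_gt0 _] _] _ _.
by rewrite comaj_cons2 ltnS leqNgt x_gt0.
Qed.

Lemma sum_end1_0 : delta 0%N = 0%N -> sum_end1 0 = 1.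
Proof.
move=> delta0; rewrite /sum_end1 /= big_cons big_nil addr0 big_ord1 delta0.
have zero n : des (nseq n.+1 1) = 0%N /\ comaj (nseq n.+1 1%N) = 0%N.
  by elim: n => [//|n IHn]; rewrite /= des_cons2 comaj_cons2 ltnn.
rewrite letters_upto_id ?all_nseq ?orbT // (zero (alpha 0%N)).1 eqxx /=.
by rewrite -(prednK alpha0) (zero _).2.
Qed.

(** The factor given by [shuf_sumE] depends on [v] only through its length and its number of
    descents, and both are prescribed. The letter 1 put in front allows insertion before the first
    letter of [v] and changes neither statistic of [v]. *)
Lemma sum_end1S k : sum_end1 k.+1 =
  sum_end1 k * shuf_weight q (\sum_(j < k.+1) alpha j) (\sum_(j < k.+1) delta j)
                 (alpha k.+1) (delta k.+1).
Proof.
rewrite /sum_end1 big_mkcond big_allpairs_dep [in RHS]big_mkcond big_distrl /=.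
apply: eq_big_seq => v vL.
have Mv := notin_words_end1 vL; have v_lt := words_end1_lt vL.
pose D := (\sum_(j < k.+1) delta j)%N.
transitivity (if has_cdt delta k v then
   shuf_sum q k.+2 1 v (alpha k.+1) (D + delta k.+1)%N else 0).
  have cdt_shuf w : w \in shuf k.+2 v (alpha k.+1) ->
      has_cdt delta k w = has_cdt delta k v.
    rewrite mem_shuf // => /andP[/eqP <- _].
    by apply/has_cdtP/has_cdtP => h i le_ik; rewrite -h ?letters_upto_filter.
  rewrite /shuf_sum; have [cdt_v | cdt_v] := ifP.
    rewrite [RHS]big_mkcond; apply: eq_big_seq => w wS.
    have wL : w \in words_end1 alpha k.+1.
      by apply/allpairsPdep; exists v, w.
    rewrite /= (cdt_shuf w wS) cdt_v andbT big_ord_recr (comaj_cons1 wL) letters_upto_id //.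
    by apply: sub_all (words_end1_lt wL).
  by rewrite big1_seq // => w /andP[_ wS]; rewrite cdt_shuf // cdt_v andbF.
case: ifP => [/has_cdtP/(_ k (leqnn k)) | _]; last by rewrite mul0r.
rewrite letters_upto_id; last by apply: sub_all v_lt.
rewrite -/D => des_v; rewrite shuf_sumE // (comaj_cons1 vL) des_v /shuf_weight_at leq_addr.
by rewrite addKn (size_words_end1 vL).
Qed.

End EndOne.

Lemma sum_end1_prim (F : fieldType) d (xi : F)
    (alpha delta alpha' delta' : nat -> nat) k :
  d.-primitive_root%R xi -> 0 < alpha 0 -> delta 0 = 0 ->
  (forall j, alpha j = d * alpha' j) -> (forall j, delta j = d * delta' j) ->
  sum_end1 alpha delta xi k = sum_end1 alpha' delta' 1%R k.
Proof.
move=> prim_xi alpha0 delta0 alphaE deltaE; have d_gt0 := prim_order_gt0 prim_xi.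
have alpha'0 : 0 < alpha' 0 by move: alpha0; rewrite alphaE muln_gt0 => /andP[].
have delta'0 : delta' 0 = 0.
  by apply/eqP; rewrite -(eqn_pmul2l d_gt0) -deltaE delta0 muln0.
have sumE (f f' : nat -> nat) n : (forall j, f j = d * f' j) ->
    \sum_(j < n) f j = d * \sum_(j < n) f' j.
  by move=> fE; rewrite big_distrr; apply: eq_bigr.
elim: k => [|k IHk]; first by rewrite !sum_end1_0.
rewrite !sum_end1S // IHk (sumE _ _ _ alphaE) (sumE _ _ _ deltaE) alphaE deltaE.
by rewrite shuf_weight_prim.
Qed.

(** * Rotations and powers of words *)

Lemma des_sum s :
  des s = \sum_(0 <= i < (size s).-1) (nth 0 s i.+1 < nth 0 s i).
Proof.
elim: s => [|x [|y s] IHs]; [by rewrite big_geq | by rewrite big_geq |].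
by rewrite des_cons2 big_nat_recl //= IHs.
Qed.

(** A descent at position $i$ contributes $i$ to [maj] and [size s - i] to [comaj]. *)
Lemma maj_comaj s : maj s + comaj s = des s * size s.
Proof.
elim: s => [|x [|y s] IHs]; [by rewrite /maj big_geq | by rewrite /maj big_geq |].
have -> : maj (x :: y :: s) = (y < x) + (maj (y :: s) + des (y :: s)).
  rewrite des_sum /maj big_mkcond [in RHS]big_mkcond /= big_ltn // !big_add1 /=.
  have -> : (if y < x then 1 else 0) = (y < x) by case: (y < x).
  rewrite -big_split /=; congr addn.
  by apply: eq_bigr => i _ /=; case: (_ < _); rewrite ?addn1.
rewrite comaj_cons2 des_cons2; move: IHs => /=; lia.
Qed.

Lemma cdesE x s : cdes (x :: s) = des (x :: rcons s x).
Proof.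
rewrite des_sum /cdes /= size_rcons big_mkcond; apply: eq_big_nat => i /andP[_ lt_i].
rewrite -rcons_cons !nth_rcons /= lt_i.
have [lt_is | ] := ltnP i (size s); last first.
  move=> le_si; have -> : i = size s by apply/eqP; rewrite eqn_leq le_si -ltnS lt_i.
  by rewrite modnn eqxx /=; case: (_ < _).
by rewrite modn_small //=; case: (_ < _).
Qed.

Lemma des_rcons s x y : des (rcons (rcons s x) y) = des (rcons s x) + (y < x).
Proof.
elim: s => [|z [|w s] IHs] /=; first by rewrite !des_cons2 addn0.
  by rewrite !des_cons2 /des /= !addn0.
by rewrite !des_cons2 /= in IHs *; rewrite IHs addnA.
Qed.

Lemma cdes_rcons s x : cdes (rcons s x) = cdes (x :: s).
Proof.
case: s => [//|y s]; rewrite rcons_cons !cdesE -!rcons_cons des_rcons !rcons_cons.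
by rewrite des_cons2 addnC.
Qed.

Lemma cdes_last s x : cdes (rcons s x) = des (x :: rcons s x).
Proof. by rewrite cdes_rcons cdesE. Qed.

Lemma cdes_rot k s : cdes (rot k s) = cdes s.
Proof.
elim: k => [|k IHk]; first by rewrite rot0.
have [le_sk | lt_ks] := leqP (size s) k; first by rewrite rot_oversize // leqW.
rewrite rotS //; case: (rot k s) IHk => [|x t] <- //.
by rewrite rot1_cons cdes_rcons.
Qed.

Lemma letters_upto_rot i k s :
  exists j, letters_upto i (rot k s) = rot j (letters_upto i s).
Proof.
exists (size (letters_upto i (take k s))).
rewrite -{3}[s](cat_take_drop k) /rot /letters_upto !filter_cat.
by rewrite drop_size_cat // take_size_cat.
Qed.

Lemma comaj_rcons s x : comaj (rcons s x) = comaj s + des (rcons s x).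
Proof.
elim: s => [|y [|z s] IHs] //=; first by rewrite comaj_cons2 des_cons2 /= muln1.
rewrite rcons_cons in IHs; rewrite !comaj_cons2 des_cons2 IHs size_rcons; lia.
Qed.

(** Moving the first letter to the end raises the weight of every cyclic descent by 1 modulo the
    length, so [comaj] changes by [cdes] modulo the length. *)
Lemma expr_comaj_rot (R : comNzRingType) (q : R) d k s :
  (q ^+ d = 1)%R -> d %| size s -> d %| cdes s ->
  (q ^+ comaj (rot k s) = q ^+ comaj s)%R.
Proof.
move=> q_d; have q_dvd n : d %| n -> (q ^+ n = 1)%R.
  by move=> /dvdnP[c ->]; rewrite mulnC exprM q_d expr1n.
move=> d_s d_c; elim: k => [|k IHk]; first by rewrite rot0.
have [le_sk | lt_ks] := leqP (size s) k; first by rewrite rot_oversize // leqW.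
have := d_s; have := d_c; rewrite -(cdes_rot k) -(size_rot k) rotS // -{}IHk.
case: (rot k s) => [//|x t]; rewrite rot1_cons => d_ct d_t.
(* The default [x] of [head] makes the correction vanish for empty [t]. *)
have eq_comaj : comaj (rcons t x) + (head x t < x) * (size t).+1
    = comaj (x :: t) + cdes (x :: t).
  case: t {d_ct d_t} => [|y t]; first by rewrite cdesE /= des_cons2 /comaj /= ltnn.
  by rewrite comaj_rcons cdesE /= comaj_cons2 des_cons2 /=; lia.
have := congr1 (fun n => q ^+ n)%R eq_comaj.
by rewrite !exprD (q_dvd (cdes _)) // (q_dvd (_ * _)) ?mulr1 // dvdn_mull.
Qed.

Definition seq_pow (T : Type) d (u : seq T) := flatten (nseq d u).

Lemma size_seq_pow (T : Type) d (u : seq T) : size (seq_pow d u) = d * size u.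
Proof. by elim: d => //= d IHd; rewrite size_cat IHd mulSn. Qed.

Lemma count_seq_pow (T : Type) (p : pred T) d u : count p (seq_pow d u) = d * count p u.
Proof. by elim: d => //= d IHd; rewrite count_cat IHd mulSn. Qed.

Lemma letters_upto_seq_pow i d u :
  letters_upto i (seq_pow d u) = seq_pow d (letters_upto i u).
Proof. by elim: d => // d IHd; rewrite -[RHS]/(_ ++ seq_pow d _) -IHd -filter_cat. Qed.

Lemma des_cat s x t : des (s ++ x :: t) = des (rcons s x) + des (x :: t).
Proof.
elim: s => [|y [|z s] IHs]; first by rewrite add0n.
  by rewrite /= !des_cons2 addn0.
by rewrite /= !des_cons2 -addnA -IHs.
Qed.

Lemma cdes_seq_pow d u : cdes (seq_pow d u) = d * cdes u.
Proof.
case: u => [|x u].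
  have -> : seq_pow d [::] = [::] :> seq nat by elim: d.
  by rewrite /cdes big_geq ?muln0.
(* Each copy is followed by the letter [x], which starts the next copy or closes the cycle, so it
   contributes [cdes (x :: u)]. *)
have des_seq_pow e : des (rcons (seq_pow e (x :: u)) x) = e * cdes (x :: u).
  elim: e => [|e IHe]; first by [].
  rewrite mulSn -IHe cdesE /seq_pow /= -/(seq_pow _ _) -rcons_cons -[RHS]/(_ + _).
  have : exists t, rcons (seq_pow e (x :: u)) x = x :: t.
    by case: (e) => [|e']; [exists [::] | exists (rcons (u ++ seq_pow e' (x :: u)) x)].
  by case=> t def_t; rewrite -cat_cons rcons_cat def_t des_cat -rcons_cons.
case: d => [|d]; first by rewrite mul0n /cdes big_geq.
by rewrite -des_seq_pow /= cdesE.
Qed.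

(** Commutation makes [u] a prefix of [v]; the rest of [v] still commutes with [u]. *)
Lemma catC_seq_pow (T : eqType) d (u v : seq T) :
  v ++ u = u ++ v -> size v = d * size u -> v = seq_pow d u.
Proof.
elim: d v => [|d IHd] v eq_uv; first by move/size0nil.
rewrite mulSn => sz_v; have def_v := cat_take_drop (size u) v.
have def_u : take (size u) v = u.
  have := congr1 (take (size u)) eq_uv.
  by rewrite takel_cat ?sz_v ?leq_addr // => ->; rewrite take_size_cat.
rewrite def_u in def_v; rewrite -def_v /=; congr (_ ++ _).
apply: IHd; last by rewrite size_drop sz_v addKn.
move: eq_uv; rewrite -{1 2}def_v -catA => /eqP.
by rewrite eqseq_cat // eqxx => /eqP.
Qed.

Lemma rot_seq_pow (T : eqType) d e (s : seq T) : 0 < d -> size s = d * e ->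
  rot e s = s -> s = seq_pow d (take e s).
Proof.
case: d => // d _ sz_s rot_s; rewrite -{1}[s](cat_take_drop e); congr (_ ++ _).
have sz_u : size (take e s) = e by rewrite size_takel // sz_s leq_pmull.
apply: catC_seq_pow; first by rewrite cat_take_drop.
by rewrite size_drop sz_u sz_s mulSn addKn.
Qed.

Lemma rot_size_seq_pow (T : Type) d (u : seq T) : rot (size u) (seq_pow d u) = seq_pow d u.
Proof.
case: d => [//|d]; rewrite /seq_pow /= rot_size_cat.
by elim: d => [|d IHd] /=; rewrite ?cats0 // -catA IHd.
Qed.

(** * Words of given content and cyclic descent type *)

Lemma size_sum_count m s : all (fun x => 0 < x <= m) s ->
  size s = \sum_(j < m) count_mem j.+1 s.
Proof.
elim: s => [|x s IHs] /=; first by rewrite big1.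
case/andP=> x_m /IHs->; rewrite big_split /= -add1n; congr (_ + _).
case: x x_m => // x lt_xm; rewrite (bigD1 (Ordinal lt_xm)) //= eqxx big1 // => i.
by rewrite -val_eqE eq_sym /= eqSS => /negPf->.
Qed.

Definition cdt_word (alpha delta : nat -> nat) m s :=
  [/\ all (fun x => 0 < x <= m) s,
      forall j, j < m -> count_mem j.+1 s = alpha j
    & forall i, i < m -> cdes (letters_upto i.+1 s) = \sum_(j < i.+1) delta j].

Lemma cdt_word_rot alpha delta m k s :
  cdt_word alpha delta m s -> cdt_word alpha delta m (rot k s).
Proof.
case=> s_le s_cnt s_cdt; split=> [|j lt_jm|i lt_im].
- by rewrite (eq_all_r (mem_rot k s)).
- by rewrite -s_cnt //; apply/seq.permP; rewrite perm_rot.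
by have [k' ->] := letters_upto_rot i.+1 k s; rewrite cdes_rot s_cdt.
Qed.

Lemma size_cdt_word alpha delta m s :
  cdt_word alpha delta m s -> size s = \sum_(j < m) alpha j.
Proof.
case=> s_le s_cnt _; rewrite (size_sum_count s_le).
by apply: eq_bigr => i _; rewrite s_cnt.
Qed.

Lemma cdes_cdt_word alpha delta k s :
  cdt_word alpha delta k.+1 s -> cdes s = \sum_(j < k.+1) delta j.
Proof.
case=> s_le _ /(_ k (ltnSn k)) <-; rewrite letters_upto_id //.
by apply: sub_all s_le => x /andP[].
Qed.

Lemma cdt_word_seq_pow alpha delta alpha' delta' m d u : 0 < d ->
  (forall j, alpha j = d * alpha' j) -> (forall j, delta j = d * delta' j) ->
  cdt_word alpha delta m (seq_pow d u) <-> cdt_word alpha' delta' m u.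
Proof.
move=> d_gt0 alphaE deltaE.
have all_seq_pow p : all p (seq_pow d u) = all p u.
  rewrite !all_count count_seq_pow size_seq_pow eqn_pmul2l //.
have sumE n : \sum_(j < n) delta j = d * \sum_(j < n) delta' j.
  by rewrite big_distrr; apply: eq_bigr.
split=> -[s_le s_cnt s_cdt]; split=> [|j lt_jm|i lt_im].
- by rewrite -all_seq_pow.
- by apply/eqP; rewrite -(eqn_pmul2l d_gt0) -count_seq_pow -alphaE s_cnt.
- by apply/eqP; rewrite -(eqn_pmul2l d_gt0) -cdes_seq_pow -letters_upto_seq_pow -sumE s_cdt.
- by rewrite all_seq_pow.
- by rewrite count_seq_pow s_cnt.
by rewrite letters_upto_seq_pow cdes_seq_pow s_cdt.
Qed.

Section WordList.
Variables (alpha delta : nat -> nat) (k : nat) (W : seq (seq nat)).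
Hypothesis W_uniq : uniq W.
Hypothesis memW : forall s, s \in W <-> cdt_word alpha delta k.+1 s.
Hypothesis alpha0 : 0 < alpha 0.

Let n := \sum_(j < k.+1) alpha j.

Lemma mem_rot_words j s : s \in W -> rot j s \in W.
Proof. by rewrite !memW; apply: cdt_word_rot. Qed.

Lemma perm_rot_words j : perm_eq (map (rot j) W) W.
Proof.
apply: uniq_perm; rewrite ?map_inj_uniq //; first exact: rot_inj.
move=> s; apply/mapP/idP => [[t tW ->] | sW]; first exact: mem_rot_words.
by exists (rotr j s); rewrite ?rotrK //; apply: mem_rot_words.
Qed.

(* Counts the pairs of a word and an occurrence of 1 in it, after rotating the
   word to bring this occurrence to the end. *)
Lemma double_count (R : comNzRingType) (f : seq nat -> R) :
  (forall j s, s \in W -> f (rot j s) = f s) ->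
  ((alpha 0)%:R * \sum_(s <- W) f s = n%:R * \sum_(s <- W | last 0%N s == 1%N) f s)%R.
Proof.
move=> f_rot.
transitivity (\sum_(s <- W) \sum_(i < n)
    (last 0%N (rot i.+1 s) == 1%N)%:R * f (rot i.+1 s))%R.
  rewrite big_distrr /=; apply: eq_big_seq => s sW.
  have sz_s : size s = n by exact: size_cdt_word (proj1 (memW s) sW).
  have [_ /(_ 0 isT) <- _] : cdt_word alpha delta k.+1 s by apply/memW.
  rewrite -sum1_count (big_nth 0) sz_s big_mkord big_mkcond natr_sum big_distrl /=.
  apply: eq_bigr => i _; rewrite f_rot //; congr (_ * _)%R.
  have lt_is : i < size s by rewrite sz_s.
  rewrite /rot (take_nth 0 lt_is) last_cat last_rcons.
  by case: (_ == _).
(* For fixed [i], rotation by [i.+1] permutes [W], so the inner sum does not depend on [i]. *)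
rewrite exchange_big /= -[X in (X%:R * _)%R](card_ord n) -sum1_card natr_sum big_distrl /=.
apply: eq_bigr => i _; rewrite mul1r [RHS]big_mkcond /=.
rewrite -[RHS](perm_big _ (perm_rot_words i.+1)) big_map /=.
by apply: eq_bigr => s _; case: (_ == _); rewrite ?mul1r ?mul0r.
Qed.

Lemma sum_last1 (R : comNzRingType) (q : R) :
  (\sum_(s <- W | last 0%N s == 1%N) q ^+ comaj s = sum_end1 alpha delta q k)%R.
Proof.
rewrite /sum_end1 -big_filter -[RHS]big_filter; apply: perm_big.
apply: uniq_perm; rewrite ?filter_uniq ?words_end1_uniq // => s.
rewrite !mem_filter.
have cdes_last1 i t : last 0 t = 1 ->
    cdes (letters_upto i.+1 t) = des (1 :: letters_upto i.+1 t).
  move=> t1; have : last 0 (letters_upto i.+1 t) = 1 by rewrite last_filter t1.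
  by case/lastP: (letters_upto _ _) => // u x; rewrite last_rcons cdes_last => ->.
apply/andP/andP => [[/eqP s1 /memW [s_le s_cnt s_cdt]] | [/has_cdtP s_cdt]].
  split; last by apply/words_end1P.
  by apply/has_cdtP => i le_ik; rewrite -cdes_last1 ?s_cdt.
case/words_end1P=> // s_le s1 s_cnt; rewrite s1; split=> //.
by apply/memW; split=> // i le_ik; rewrite cdes_last1 ?s_cdt.
Qed.

(** Applied twice: to [alpha], [delta] at a root of unity of order [d], and to the scaled
    compositions at $q=1$, where the left-hand sum counts words. *)
Lemma sum_comaj (R : comNzRingType) (q : R) d :
  (q ^+ d = 1)%R -> (forall j, d %| alpha j) -> (forall j, d %| delta j) ->
  ((alpha 0)%:R * \sum_(s <- W) q ^+ comaj s = n%:R * sum_end1 alpha delta q k)%R.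
Proof.
move=> q_d d_alpha d_delta; rewrite -sum_last1; apply: double_count => j s /memW s_cdt.
apply: (expr_comaj_rot _ q_d).
  by rewrite (size_cdt_word s_cdt) dvdn_sum.
by rewrite (cdes_cdt_word s_cdt) dvdn_sum.
Qed.
End WordList.

(** Positivity of the last part makes the largest letter equal to [size alpha]. *)
Lemma contentP (alpha s : seq nat) : all (fun a => 0 < a) alpha ->
  content s = alpha <->
  all (fun x => x <= size alpha) s /\
  forall j, j < size alpha -> count_mem j.+1 s = nth 0 alpha j.
Proof.
move=> alpha_gt0; split=> [def_alpha | [s_le s_cnt]].
  have max_s : \max_(x <- s) x = size alpha.
    by rewrite -def_alpha size_map size_iota.
  split=> [|j lt_j].
    by apply/allP => x xs; rewrite -max_s; apply: (leq_bigmax_seq (F := id)).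
  rewrite -[alpha in RHS]def_alpha (nth_map 0) ?size_iota ?max_s //.
  by rewrite nth_iota.
have max_s : \max_(x <- s) x = size alpha.
  apply/eqP; rewrite eqn_leq; apply/andP; split.
    by apply/bigmax_leqP_seq => x xs _; apply: (allP s_le).
  case def_m: (size alpha) => [|m] //; apply: (leq_bigmax_seq (F := id)) => //.
  rewrite -has_pred1 has_count s_cnt ?def_m //.
  by apply: (allP alpha_gt0); rewrite mem_nth ?def_m.
apply: (@eq_from_nth _ 0); rewrite size_map size_iota max_s // => j lt_j.
by rewrite (nth_map 0) ?size_iota max_s // nth_iota // s_cnt.
Qed.

Lemma CDTP (delta s : seq nat) : is_word s -> size (content s) = size delta ->
  CDT s = [seq d%:Z | d <- delta]%R <->
  forall i, i < size delta ->
    cdes (letters_upto i.+1 s) = \sum_(j < i.+1) nth 0 delta j.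
Proof.
move=> s_gt0 sz; rewrite /CDT sz.
have upto0 : cdes (letters_upto 0 s) = 0.
  have -> : letters_upto 0 s = [::].
    rewrite /letters_upto; apply/eqP; rewrite -(negbK (_ == _)) -has_filter -all_predC.
    by apply: sub_all s_gt0 => x /=; rewrite leqn0 -lt0n.
  by rewrite /cdes big_geq.
have nthE i : i < size delta ->
   nth 0%R [seq ((cdes (letters_upto i s))%:Z - (cdes (letters_upto i.-1 s))%:Z)%R
     | i <- iota 1 (size delta)] i
   = ((cdes (letters_upto i.+1 s))%:Z - (cdes (letters_upto i s))%:Z)%R.
  by move=> lt_i; rewrite (nth_map 0) ?size_iota // nth_iota.
split=> [eq_cdt | s_cdt].
  have step i : i < size delta ->
      cdes (letters_upto i.+1 s) = cdes (letters_upto i s) + nth 0 delta i.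
    move=> lt_i; have := congr1 (fun t => nth 0%R t i) eq_cdt.
    by rewrite nthE // (nth_map 0) // => /eqP; rewrite subr_eq -PoszD addnC => /eqP[].
  elim=> [|i IHi] lt_i; first by rewrite step // upto0 big_ord1.
  by rewrite step // IHi ?(ltnW lt_i) // [RHS]big_ord_recr.
apply: (@eq_from_nth _ 0%R); rewrite !size_map size_iota // => i lt_i.
rewrite nthE // (nth_map 0) // s_cdt //.
case: i lt_i => [|i] lt_i; first by rewrite upto0 subr0 big_ord1.
by rewrite s_cdt ?(ltnW lt_i) // big_ord_recr /= PoszD addrAC subrr add0r.
Qed.

Section Words.
Variables (m : nat) (alpha delta : m.-tuple nat).
Hypothesis alpha_gt0 : all (fun a => 0 < a) alpha.

Let A := nth 0 alpha.
Let D := nth 0 delta.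

Lemma in_words w : w \in words alpha delta <-> cdt_word A D m (seq_of w).
Proof.
rewrite inE; split.
  case/and3P=> w_gt0 /eqP def_c /eqP def_d.
  have sz : size (content (seq_of w)) = size delta by rewrite def_c !size_tuple.
  have [w_le w_cnt] := (contentP _ alpha_gt0).1 def_c.
  have := (CDTP w_gt0 sz).1 def_d; rewrite !size_tuple in w_le w_cnt * => w_cdt.
  split=> //; apply/allP => x xw.
  by rewrite (allP w_gt0) ?(allP w_le).
case=> w_le w_cnt w_cdt.
have w_gt0 : is_word (seq_of w) by apply: sub_all w_le => x /andP[].
have def_c : content (seq_of w) = alpha.
  apply/(contentP _ alpha_gt0); rewrite size_tuple; split=> //.
  by apply: sub_all w_le => x /andP[].
have sz : size (content (seq_of w)) = size delta by rewrite def_c !size_tuple.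
by rewrite w_gt0 def_c eqxx; apply/eqP/(CDTP w_gt0 sz); rewrite size_tuple.
Qed.

Definition word_list : seq (seq nat) :=
  [seq seq_of w | w <- enum (words alpha delta)].

Lemma seq_of_inj n : injective (@seq_of n m).
Proof. by move=> v w eq_vw; apply: val_inj; apply: (inj_map val_inj) eq_vw. Qed.

Lemma word_list_uniq : uniq word_list.
Proof. by rewrite map_inj_uniq ?enum_uniq //; exact: seq_of_inj. Qed.

Lemma mem_word_list s : s \in word_list <-> cdt_word A D m s.
Proof.
split=> [/mapP[w] | s_W]; first by rewrite mem_enum => /in_words w_W ->.
have [s_le s_cnt s_cdt] := s_W.
have s_gt0 : is_word s by apply: sub_all s_le => x /andP[].
have def_c : content s = alpha.
  apply/(contentP _ alpha_gt0); rewrite size_tuple; split=> //.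
  by apply: sub_all s_le => x /andP[].
have sz : size (content s) = size delta by rewrite def_c !size_tuple.
have def_d : CDT s = [seq d%:Z | d <- delta]%R.
  by apply/(CDTP s_gt0 sz); rewrite size_tuple.
have [w w_W <-] := words_complete s_gt0 def_c def_d.
by rewrite map_f ?mem_enum.
Qed.

Lemma sum_nth_tuple : \sum_(j < m) A j = sumn alpha.
Proof. by rewrite sumnE (big_nth 0) size_tuple big_mkord. Qed.

Lemma sum_words (R : nmodType) (f : seq nat -> R) (P : pred (seq nat)) :
  (\sum_(w in words alpha delta | P (seq_of w)) f (seq_of w) =
   \sum_(s <- word_list | P s) f s)%R.
Proof. by rewrite /word_list big_map big_enum_cond. Qed.
End Words.

(** * Cyclic sieving *)

Lemma words_maj_eval m (alpha delta : m.-tuple nat) (z : algC) :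
  ((map_poly (fun c : nat => c%:R) (words_maj alpha delta)).[z] =
  \sum_(w in words alpha delta) z ^+ maj (seq_of w))%R.
Proof.
rewrite /words_maj.
rewrite (raddf_sum (map_poly (GRing.natmul 1))) horner_sum.
apply: eq_bigr => w _; rewrite -[RHS]hornerXn; congr horner.
by apply/polyP => i; rewrite coef_map_id0 // !coefXn; case: eqP.
Qed.

Lemma iter_gcd (T : Type) (r : T -> T) a n w : 0 < n -> iter n r w = w ->
  iter a r w = w <-> iter (gcdn a n) r w = w.
Proof.
move=> n_gt0 r_n.
have iter_mul b c : iter b r w = w -> iter (c * b) r w = w.
  by move=> r_b; elim: c => // c IHc; rewrite mulSn iterD IHc.
split=> [r_a | r_gcd]; last by case/dvdnP: (dvdn_gcdl a n) => c ->; apply: iter_mul.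
have [->|a_gt0] := posnP a; first by rewrite gcd0n.
(* Bezout in the form [u * a = v * n + gcdn a n]. *)
case: (egcdnP n a_gt0) => u v def_gcd _.
by rewrite -[RHS](iter_mul a u r_a) def_gcd addnC iterD iter_mul.
Qed.

Section Rotation.
Variables (n m : nat).
Implicit Type w : n.-tuple 'I_m.+1.

Lemma seq_of_rotate k w : k <= n ->
  seq_of (iter k (@rotate n _) w) = rotr k (seq_of w).
Proof.
move=> le_kn; rewrite /seq_of -map_rotr; congr map.
elim: k le_kn => [|k IHk] lt_kn; first by rewrite /= /rotr subn0 rot_size.
rewrite /= IHk ?(ltnW lt_kn) // [rotr k _]/rotr [RHS]/rotr size_tuple -(subnSK lt_kn).
by rewrite rotS ?rotK // size_tuple subnSK ?leq_subr.
Qed.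

Lemma rotate_fix k w : k <= n ->
  (iter k (@rotate n _) w == w) = (rot k (seq_of w) == seq_of w).
Proof.
move=> le_kn; rewrite -(inj_eq (@seq_of_inj m n)) seq_of_rotate //.
by rewrite eq_sym -[LHS](inj_eq (@rot_inj k _)) rotrK eq_sym.
Qed.
End Rotation.

Section Sieving.
Variables (m : nat) (alpha delta : m.+1.-tuple nat).
Hypothesis alpha_gt0 : all (fun a => 0 < a) alpha.
Variable d : nat.
Hypothesis d_gt0 : 0 < d.
Hypothesis d_dvd : d %| gcd_parts alpha delta.

Let n := sumn alpha.
Let alpha' := map_tuple (divn^~ d) alpha.
Let delta' := map_tuple (divn^~ d) delta.

Lemma dvd_parts x : x \in alpha ++ delta -> d %| x.
Proof.
move=> xs; apply: dvdn_trans d_dvd _; rewrite /gcd_parts.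
elim: (_ ++ _) xs => // y s IHs; rewrite inE big_cons => /orP[/eqP->|/IHs].
  exact: dvdn_gcdl.
exact/dvdn_trans/dvdn_gcdr.
Qed.

Lemma nth_scaled (s : seq nat) j : (forall x, x \in s -> d %| x) ->
  nth 0 s j = d * nth 0 (map (divn^~ d) s) j.
Proof.
move=> d_s; have [lt_js | le_sj] := ltnP j (size s).
  by rewrite (nth_map 0) // mulnC divnK // d_s // mem_nth.
by rewrite !nth_default ?size_map ?muln0.
Qed.

Lemma alphaE j : nth 0 alpha j = d * nth 0 alpha' j.
Proof. by apply: nth_scaled => x xs; rewrite dvd_parts // mem_cat xs. Qed.

Lemma deltaE j : nth 0 delta j = d * nth 0 delta' j.
Proof. by apply: nth_scaled => x xs; rewrite dvd_parts // mem_cat xs orbT. Qed.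

Lemma alpha'_gt0 : all (fun a => 0 < a) alpha'.
Proof.
rewrite all_map; apply/allP => x xs /=; rewrite divn_gt0 // dvdn_leq //.
  exact: (allP alpha_gt0).
by rewrite dvd_parts // mem_cat xs.
Qed.

Lemma sumn_scaled : n = d * sumn alpha'.
Proof.
rewrite /n -!sum_nth_tuple big_distrr; apply: eq_bigr => j _; exact: alphaE.
Qed.

Lemma perm_fixed_words :
  perm_eq [seq s <- word_list alpha delta | rot (n %/ d) s == s]
          [seq seq_pow d u | u <- word_list alpha' delta'].
Proof.
have n_d : n %/ d = sumn alpha' by rewrite sumn_scaled mulKn.
have sz u : u \in word_list alpha' delta' -> size u = sumn alpha'.
  move/(mem_word_list _ alpha'_gt0)/size_cdt_word->; exact: sum_nth_tuple.
have pow_iff := cdt_word_seq_pow m.+1 _ d_gt0 alphaE deltaE.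
apply: uniq_perm; first by rewrite filter_uniq // word_list_uniq.
  rewrite map_inj_in_uniq ?word_list_uniq // => u v /sz su /sz sv eq_uv.
  have := congr1 (take (sumn alpha')) eq_uv; case: (d) d_gt0 => // e _.
  by rewrite /seq_pow /= !take_size_cat.
move=> s; rewrite mem_filter n_d; apply/andP/mapP.
  case=> /eqP rot_s /(mem_word_list _ alpha_gt0) s_W.
  have sz_s : size s = d * sumn alpha'.
    by rewrite (size_cdt_word s_W) sum_nth_tuple -sumn_scaled.
  have def_s := rot_seq_pow d_gt0 sz_s rot_s.
  exists (take (sumn alpha') s) => //; apply/(mem_word_list _ alpha'_gt0).
  by apply/pow_iff; rewrite -def_s.
case=> u u_W ->; split; first by rewrite -(sz u u_W) rot_size_seq_pow.
by apply/(mem_word_list _ alpha_gt0)/pow_iff/(mem_word_list _ alpha'_gt0).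
Qed.

Lemma card_fixed_words (z : algC) : d.-primitive_root%R z -> nth 0 delta 0 = 0 ->
  (#|[set w in words alpha delta | rot (n %/ d) (seq_of w) == seq_of w]|%:R
   = \sum_(w in words alpha delta) z ^+ maj (seq_of w))%R.
Proof.
move=> prim_z delta0; have prim_zV := prim_rootV prim_z.
have z_d := prim_expr_order prim_z.
have alpha0 : 0 < nth 0 alpha 0 by apply: (allP alpha_gt0); rewrite mem_nth ?size_tuple.
have alpha'0 : 0 < nth 0 alpha' 0 by apply: (allP alpha'_gt0); rewrite mem_nth ?size_tuple.
have d_n : d %| n by rewrite sumn_scaled dvdn_mulr.
have -> : (\sum_(w in words alpha delta) z ^+ maj (seq_of w) =
           \sum_(s <- word_list alpha delta) z^-1 ^+ comaj s)%R.
  rewrite -(@sum_words _ _ _ _ (fun s => z^-1 ^+ comaj s)%R xpredT).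
  under [RHS]eq_bigl do rewrite andbT.
  apply: eq_bigr => w _; apply: (@mulIf _ (z ^+ comaj (seq_of w))%R).
    rewrite expf_neq0 // (prim_root_eq0 prim_z) -lt0n //.
  (* [maj + comaj] is a multiple of the length, hence of [d]. *)
  rewrite -exprD maj_comaj exprVn mulVf.
    have -> : size (seq_of w) = d * sumn alpha' by rewrite size_map size_tuple -sumn_scaled.
    by rewrite mulnCA exprM z_d expr1n.
  rewrite expf_neq0 // (prim_root_eq0 prim_z) -lt0n //.
have -> : #|[set w in words alpha delta | rot (n %/ d) (seq_of w) == seq_of w]|
   = size (word_list alpha' delta').
  rewrite -sum1_card -(size_map (seq_pow d)) -(perm_size perm_fixed_words) size_filter.
  rewrite -sum1_count -(@sum_words _ _ _ nat (fun _ => 1) (fun s => rot (n %/ d) s == s)).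
  by apply: eq_bigl => w; rewrite inE.
have sumA := sum_comaj (word_list_uniq alpha delta)
  (mem_word_list delta alpha_gt0) alpha0 (prim_expr_order prim_zV).
have sumA' := sum_comaj (word_list_uniq alpha' delta')
  (mem_word_list delta' alpha'_gt0) alpha'0 (expr1n algC 1).
(* Now both identities involve the same sum over words ending with 1. Since $\alpha_1=d\alpha'_1$
   and $n=dn'$, cancelling $d\alpha'_1$ gives the claim. *)
rewrite (sum_end1_prim _ prim_zV alpha0 delta0 alphaE deltaE) in sumA.
have dA j : d %| nth 0 alpha j by rewrite alphaE dvdn_mulr.
have dD j : d %| nth 0 delta j by rewrite deltaE dvdn_mulr.
move: {sumA}(sumA dA dD) {sumA'}(sumA' (fun _ => dvd1n _) (fun _ => dvd1n _)).
rewrite !sum_nth_tuple -/n sumn_scaled alphaE !natrM.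
under [in X in _ -> X -> _]eq_bigr do rewrite expr1n.
rewrite big_const_seq count_predT iter_addr_0 => eq1 eq2.
have nz : (d%:R * (nth 0%N alpha' 0)%:R != 0 :> algC)%R.
  by rewrite -natrM Num.Theory.pnatr_eq0 -lt0n muln_gt0 d_gt0.
by apply: (mulfI nz); rewrite eq1 -!mulrA eq2.
Qed.
End Sieving.

(** Replaces the integer [j] by its natural representative modulo [g], which is also the number of
    times that the generator acts. *)
Lemma expr_cyclic_gen (g : nat) (z : algC) (j : int) : g.-primitive_root%R z ->
  (z ^ j = z ^+ expgz (cyclic_gen g) j)%R.
Proof.
move=> prim_z; have g_gt0 := prim_order_gt0 prim_z.
have z_mod i : (z ^+ (i %% g.-1.+1) = z ^+ i)%R.
  by rewrite prednK // prim_expr_mod.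
have zM (a b : 'I_g.-1.+1) : (z ^+ (a * b)%g = z ^+ a * z ^+ b)%R.
  by rewrite -exprD -[RHS]z_mod.
have zX i : (z ^+ (cyclic_gen g ^+ i)%g = z ^+ i)%R.
  elim: i => [//|i IHi]; rewrite expgS zM IHi exprS; congr (_ * _)%R.
  by rewrite /= z_mod.
case: j => i /=; first by rewrite zX.
have z_neq0 : (z ^+ i.+1 != 0)%R by rewrite expf_neq0 // (prim_root_eq0 prim_z) -lt0n.
have inv_i : (z ^+ (cyclic_gen g ^+ i.+1)%g * z ^+ (cyclic_gen g ^- i.+1)%g = 1)%R.
  by rewrite -zM mulgV.
by rewrite zX in inv_i; apply: (mulfI z_neq0); rewrite divff // -[LHS]inv_i.
Qed.

Theorem theorem6p6 (m : nat) (alpha delta : m.-tuple nat)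
    (alpha_strong : all (fun a => 0 < a)%N alpha)
    (n_ge1 : (1 <= sumn alpha)%N)
    (delta_1 : nth 0%N delta 0 = 0%N) :
  exhibits_CSP (words alpha delta)
    (cyclic_gen (gcd_parts alpha delta))
    (rotation_action 'I_m.+1 (gcd_parts_dvd_sum alpha delta))
    (words_maj alpha delta).
Proof.
case: m alpha delta alpha_strong n_ge1 delta_1 => [|m] alpha delta alpha_gt0 n_gt0 delta0.
  by rewrite (tuple0 alpha) in n_gt0.
have g_gt0 := gcd_parts_gt0 delta n_gt0; have g_n := gcd_parts_dvd_sum alpha delta.
set g := gcd_parts alpha delta in g_gt0 g_n *; set n := sumn alpha in n_gt0 g_n *.
have actE w (a : 'I_g.-1.+1) :
    rotation_action 'I_m.+2 (gcd_parts_dvd_sum alpha delta) w a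
    = iter (a * (n %/ g)) (@rotate n _) w.
  by rewrite iterM.
split.
  apply/subsetP => a _; rewrite !inE /=; apply/subsetP => w w_W;
    rewrite inE /rot_act -iterM.
  elim: (a * _) => //= i; rewrite !(in_words _ alpha_gt0) /seq_of /= map_rotr.
  exact: cdt_word_rot.
rewrite order_cyclic_gen // => z prim_z j.
rewrite words_maj_eval (expr_cyclic_gen _ prim_z); set a := expgz _ _.
(* [d] is the order [g %/ gcdn a g] of [z ^+ a]. *)
have prim_za := exp_prim_root prim_z a; set d := g %/ _ in prim_za.
have d_g : d %| g by apply/dvdnP; exists (gcdn a g); rewrite mulnC divnK ?dvdn_gcdr.
rewrite -(card_fixed_words alpha_gt0 (prim_order_gt0 prim_za) d_g prim_za delta0);
  congr (_%:R)%R.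
have le_n : n %/ d <= n by exact: leq_div.
apply: eq_card => w; rewrite !inE; congr (_ && _); rewrite -rotate_fix // actE.
(* Rotations by [a * (n %/ g)] and by [n %/ d] fix the same words, as
   $\gcd(an/g,n)=(n/g)\gcd(a,g)=n/d$. *)
have gcdE : gcdn (a * (n %/ g)) n = n %/ d.
  have n_d : n = d * gcdn a g * (n %/ g) by rewrite divnK ?dvdn_gcdr // mulnC divnK.
  rewrite [in RHS]n_d -mulnA mulKn ?(prim_order_gt0 prim_za) //.
  by rewrite -{2}(divnK g_n) [_ %/ g * g]mulnC -muln_gcdl.
rewrite -gcdE; apply/eqP/eqP; rewrite -iter_gcd //; exact: iter_rotate_size.
Qed.
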